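(* The scheme $$v_{k+1}=\Phi_k v_k+M^{-1}[\Phi_k-I]\,[\theta g(\varepsilon,v_k)+(1-\theta)g(\varepsilon,v_{k+1})],\qquad k\ge 0,\ \theta\in[0,1],$$ with the stochastic nonlinear reaction term frozen is, for $\tau_k\ge0$ sufficiently small, unconditionally stable in the von Neumann sense under the spectral norm. That is: there exist $\tau^*>0$ and a constant $C>0$, where $C$ is independent of $k$ and of the time steps $\tau_j$, such that for all step sequences with $0\le\tau_j\le\tau^*$, every sequence of errors $(z_k)_{k\ge0}$ in $\mathbb{R}^{N_xN_y}$ satisfying $z_{k+1}=\Phi_kz_k$ for $k\ge0$ obeys $$\|z_{k+1}\|_2\le C\|z_0\|_2,\qquad k\ge 0 .$$
   Context: Mesh: $\mathcal{D}=(-1,1)\times(-1,1)$, $a,b>0$, $N_x,N_y$ are (large) positive integers, $-1=x_0<x_1<\dots<x_{N_x+1}=1$, $-1=y_0<\dots<y_{N_y+1}=1$, $h_{x,i}=x_{i+1}-x_i>0$ ($0\le i\le N_x$), $h_{y,j}=y_{j+1}-y_j>0$ ($0\le j\le N_y$); the mesh is otherwise arbitrary. The degeneracy function $\sigma:\overline{\mathcal{D}}\to[0,\infty)$ vanishes only on a subset of $\partial\mathcal{D}$; $\sigma_{i,j}=\sigma(x_i,y_j)$. Interior grid vectors in $\mathbb{R}^{N_xN_y}$ are ordered lexicographically: $(v_{1,1},v_{2,1},\dots,v_{N_x,1},v_{1,2},\dots,v_{N_x,N_y})^T$. Matrices: $B=\mathrm{diag}(\sigma_{1,1}^{-1},\sigma_{2,1}^{-1},\dots,\sigma_{N_x,N_y}^{-1})$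 (same ordering); for $\alpha\in\{x,y\}$, $T_\alpha\in\mathbb{R}^{N_\alpha\times N_\alpha}$ is tridiagonal with $(T_\alpha)_{i,i}=-\frac{2}{h_{\alpha,i-1}h_{\alpha,i}}$, $(T_\alpha)_{i,i+1}=\frac{2}{h_{\alpha,i}(h_{\alpha,i-1}+h_{\alpha,i})}$, $(T_\alpha)_{i+1,i}=\frac{2}{h_{\alpha,i}(h_{\alpha,i}+h_{\alpha,i+1})}$; $M_x=a^{-2}B(I_{N_y}\otimes T_x)$, $M_y=b^{-2}B(T_y\otimes I_{N_x})$, $M=M_x+M_y$. With time steps $\tau_k$ and $E(A)=e^{A}$ the matrix exponential, $\Phi_{x,k}=E(\tau_kM_x/2)$, $\Phi_{y,k}=E(\tau_kM_y)$, $\Phi_k=\Phi_{x,k}\Phi_{y,k}\Phi_{x,k}$. ''Frozen'' means that the reaction term $\theta g(\varepsilon,v_k)+(1-\theta)g(\varepsilon,v_{k+1})$ is not perturbed, so that the difference $z_k=v_k-\tilde v_k$ between a numerical solution $v_k$ and a perturbed one $\tilde v_k$ satisfies $z_{k+1}=\Phi_kz_k$. *)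

(* Defs.v *)
From HB Require Import structures.
From mathcomp Require Import all_boot all_order all_algebra.
From mathcomp Require Import all_classical all_reals all_analysis.
From mathcomp.real_closed Require Export mxtens.

Set Implicit Arguments.
Unset Strict Implicit.
Unset Printing Implicit Defensive.

Import Order.TTheory GRing.Theory Num.Theory.
Import numFieldNormedType.Exports.

Local Open Scope classical_set_scope.
Local Open Scope ring_scope.

Definition norm2 (R : realType) (n : nat) (v : 'cV[R]_n) : R :=
  Num.sqrt (\sum_(i < n) v i 0 ^+ 2).

(* The series converges in the topology of 'M[R]_n given by the entrywise
   sup norm, the one MathComp-Analysis puts on matrices. *)
Definition expmx (R : realType) (n : nat) (A : 'M[R]_n) : 'M[R]_n :=
  limn (series (fun k : nat => (k`!%:R)^-1 *: A ^+ k) : nat -> 'M[R]_n).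

(* Only the points x 0, ..., x N.+1 matter. *)
Definition is_mesh (R : realType) (N : nat) (x : nat -> R) : Prop :=
  [/\ x 0%N = -1, x N.+1 = 1 & forall i : nat, (i <= N)%N -> x i < x i.+1].

Definition mesh_step (R : realType) (x : nat -> R) (i : nat) : R :=
  x i.+1 - x i.

(* Only the values of sigma on the closed square [-1, 1] x [-1, 1] matter. *)
Definition is_degeneracy (R : realType) (sigma : R -> R -> R) : Prop :=
  forall s t : R, -1 <= s <= 1 -> -1 <= t <= 1 ->
    0 <= sigma s t /\ (sigma s t = 0 -> `|s| = 1 \/ `|t| = 1).

(* Rows and columns are numbered from 0: index i : 'I_N stands for the mesh
   point x i.+1, hence the shift between the indices of h here and those of the
   usual formulas, which number the interior points from 1. *)
Definition Tmx (R : realType) (N : nat) (x : nat -> R) : 'M[R]_N :=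
  let h := mesh_step x in
  \matrix_(i < N, j < N)
    if j == i :> nat then - (2 / (h i * h i.+1))
    else if j == i.+1 :> nat then 2 / (h i.+1 * (h i + h i.+1))
    else if i == j.+1 :> nat then 2 / (h j.+1 * (h j.+1 + h j.+2))
    else 0.

(* In 'I_(Ny * Nx) the pair (j, i) : 'I_Ny * 'I_Nx has rank j * Nx + i, i.e.
   the x-index varies fastest; this is also the convention of *t. *)
Definition Bmx (R : realType) (Nx Ny : nat) (x y : nat -> R)
    (sigma : R -> R -> R) : 'M[R]_(Ny * Nx) :=
  diag_mx (\row_(k < Ny * Nx)
    let ji := mxtens_unindex k in (sigma (x ji.2.+1) (y ji.1.+1))^-1).

Definition Mx (R : realType) (Nx Ny : nat) (x y : nat -> R)
    (sigma : R -> R -> R) (a : R) : 'M[R]_(Ny * Nx) :=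
  a ^- 2 *: (Bmx Nx Ny x y sigma *m (1%:M *t Tmx Nx x)).

Definition My (R : realType) (Nx Ny : nat) (x y : nat -> R)
    (sigma : R -> R -> R) (b : R) : 'M[R]_(Ny * Nx) :=
  b ^- 2 *: (Bmx Nx Ny x y sigma *m (Tmx Ny y *t 1%:M)).

Definition Phi (R : realType) (n : nat) (Ax Ay : 'M[R]_n) (tau : R) : 'M[R]_n :=
  expmx ((tau / 2) *: Ax) *m expmx (tau *: Ay) *m expmx ((tau / 2) *: Ax).

(* One step of the splitting scheme, with g and g' the values of the reaction
   term at the old and at the new time level. *)
Definition splitting_step (R : realType) (n : nat) (Ax Ay : 'M[R]_n)
    (tau theta : R) (g g' v : 'cV[R]_n) : 'cV[R]_n :=
  Phi Ax Ay tau *m v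
  + invmx (Ax + Ay) *m (Phi Ax Ay tau - 1%:M)
    *m (theta *: g + (1 - theta) *: g').

(* With the reaction term frozen, i.e. unperturbed, the error of the scheme
   obeys the homogeneous recursion z_{k+1} = Phi_k z_k. *)
Lemma splitting_step_frozen_error (R : realType) (n : nat) (Ax Ay : 'M[R]_n)
    (tau theta : R) (g g' v w : 'cV[R]_n) :
  splitting_step Ax Ay tau theta g g' v - splitting_step Ax Ay tau theta g g' w
  = Phi Ax Ay tau *m (v - w).
Proof. by rewrite /splitting_step opprD addrACA subrr addr0 mulmxBr. Qed.

(* Main.v *)
Require Import Defs.
From HB Require Import structures.
From mathcomp Require Import all_boot all_order all_algebra.
From mathcomp Require Import all_classical all_reals all_analysis.
From mathcomp Require Import ring.

Import Order.TTheory GRing.Theory Num.Theory.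
Import numFieldNormedType.Exports.
Local Open Scope classical_set_scope.
Local Open Scope ring_scope.

(** The proof uses the maximum principle instead of the spectral norm.  With
    the mesh points numbered from 0 and [h_i = x_(i+1) - x_i], the row of [Tmx]
    that belongs to the point [x_i] has nonnegative off-diagonal entries, and
    away from the boundary it sums to zero:
    [2 / (h_i (h_(i-1) + h_i)) + 2 / (h_(i-1) (h_(i-1) + h_i))
     = 2 / (h_(i-1) h_i)],
    while next to the boundary the positive terms that belong to [x_0] and
    [x_(N+1)] are dropped, which makes the sum negative.  Hence
    [Tmx] generates a sub-Markov semigroup ([subgenerator_Tmx]).  This property
    survives tensoring with an identity, left multiplication by a nonnegative
    diagonal matrix and nonnegative scaling, so it passes to [Mx], [My] and all
    their nonnegative multiples.

    The exponential of such a matrix [A] does not increase the sup norm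
    ([expmx_subgenerator_contraction]).  Indeed, for [m >= `|A|] the matrix
    [1 + A / m] has nonnegative entries and row sums at most 1, so its powers
    are sup-norm contractions, and [(1 + A / m) ^ m] tends to [exp A].  The
    convergence is inherited from the scalar one: the coefficients
    [1 / k! - C(m, k) / m ^ k] of the difference between the Taylor polynomial
    and [(1 + A / m) ^ m] are nonnegative, so this difference is bounded by the
    same expression with [A] replaced by a scalar dominating its norm
    ([expmx_partial_sum_sub_euler]).

    Every [Phi] is therefore a sup-norm contraction, and so is any product of
    them, for arbitrary nonnegative time steps.  Comparing the sup norm with the
    Euclidean norm in dimension [Ny * Nx] costs the factor
    [sqrt (Ny * Nx)], which is the constant [C]. *)

(** * The sup norm of matrix products *)

(** Joins completeness with the sup norm, so that [normed_cvg] applies to series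
    of matrices. *)
HB.instance Definition _ (R : realType) (m n : nat) :=
  Complete.on 'M[R]_(m, n).

Lemma ler_mx_norm_entry {R : realType} {m n : nat} (A : 'M[R]_(m, n)) i j :
  `|A i j| <= `|A|.
Proof.
rewrite [leRHS]/Num.Def.normr /= mx_normrE.
exact: (le_bigmax _ (fun ij : 'I_m * 'I_n => `|A ij.1 ij.2|) (i, j)).
Qed.

Lemma mx_norm_ler {R : realType} {m n : nat} (A : 'M[R]_(m, n)) (e : R) :
  0 <= e -> (forall i j, `|A i j| <= e) -> `|A| <= e.
Proof.
move=> e0 Ae; rewrite [leLHS]/Num.Def.normr /= mx_normrE.
by apply: bigmax_le => // -[i j] _; exact: Ae.
Qed.

Lemma mx_norm_mulmx_rowsum {R : realType} {m n p : nat} (c : R)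
    (A : 'M[R]_(m, n)) (B : 'M[R]_(n, p)) :
  0 <= c -> (forall i, \sum_j `|A i j| <= c) -> `|A *m B| <= c * `|B|.
Proof.
move=> c0 Ac; apply: mx_norm_ler => [|i j]; first by rewrite mulr_ge0.
rewrite mxE (le_trans (ler_norm_sum _ _ _)) //.
rewrite (@le_trans _ _ (\sum_k `|A i k| * `|B|)) //.
  by apply: ler_sum => k _; rewrite normrM ler_wpM2l // ler_mx_norm_entry.
by rewrite -mulr_suml ler_wpM2r.
Qed.

Lemma mx_norm_mulmx {R : realType} {m n p : nat}
    (A : 'M[R]_(m, n)) (B : 'M[R]_(n, p)) :
  `|A *m B| <= n%:R * `|A| * `|B|.
Proof.
apply: mx_norm_mulmx_rowsum => [|i]; first by rewrite mulr_ge0.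
rewrite (le_trans (ler_sum _ (fun j _ => ler_mx_norm_entry A i j))) //.
by rewrite sumr_const card_ord mulr_natl.
Qed.

Lemma mx_norm_exprM {R : realType} {n p : nat} (A : 'M[R]_n)
    (B : 'M[R]_(n, p)) (k : nat) :
  `|A ^+ k *m B| <= (n%:R * `|A|) ^+ k * `|B|.
Proof.
elim: k => [|k IH]; first by rewrite !expr0 mul1mx mul1r.
rewrite !exprS -mulmxA (le_trans (mx_norm_mulmx _ _)) // -[leRHS]mulrA.
by rewrite ler_wpM2l // mulr_ge0.
Qed.

(** * The matrix exponential as a limit of Euler steps *)

(** The terms are dominated by those of the scalar exponential series at
    [n%:R * `|A|]; the factor [n] appears because the sup norm is not
    submultiplicative. *)
Lemma cvg_expmx {R : realType} {n : nat} (A : 'M[R]_n) :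
  (series (fun k : nat => (k`!%:R)^-1 *: A ^+ k) : nat -> 'M[R]_n)
    @ \oo --> expmx A.
Proof.
suff: cvgn (series (fun k : nat => (k`!%:R)^-1 *: A ^+ k) : nat -> 'M[R]_n).
  by [].
apply: normed_cvg.
apply: (@series_le_cvg _ _
  (fun k => `|1%:M : 'M[R]_n| * exp_coeff (n%:R * `|A|) k)) => [k|k|k|].
- exact: normr_ge0.
- by rewrite /exp_coeff /= !mulr_ge0 // exprn_ge0 // mulr_ge0.
- rewrite /exp_coeff /= normrZ normfV normr_nat.
  rewrite -[in leLHS](mulmx1 (A ^+ k)) mulrC mulrA ler_wpM2r // ?invr_ge0 //.
  by rewrite [leRHS]mulrC mx_norm_exprM.
- exact: is_cvg_seriesZ (is_cvg_series_exp_coeff _).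
Qed.

(** This is [exprZn] without the algebra structure, which square matrices carry
    only in sizes of the form [n.+1]. *)
Lemma scalemx_exprn {R : comPzRingType} {n : nat} (c : R) (A : 'M[R]_n) k :
  (c *: A) ^+ k = c ^+ k *: A ^+ k.
Proof.
elim: k => [|k IH]; first by rewrite !expr0 scale1r.
by rewrite !exprS IH /= -[LHS]/(_ *m _) -scalemxAl -scalemxAr scalerA.
Qed.

Lemma ffact_le_expn (m k : nat) : (m ^_ k <= m ^ k)%N.
Proof.
elim: k m => [//|k IH] [//|m]; rewrite ffactSS expnS leq_mul2l /=.
rewrite (leq_trans (IH m)) //; case: k {IH} => // k.
by rewrite leq_exp2r.
Qed.

(** The coefficients of [(1 + X / m) ^ m] stay below those of [exp X], because
    [C(m, k) k!] is a falling factorial of [m]. *)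
Lemma euler_coef_le {R : realFieldType} (m k : nat) :
  m.+1%:R^-1 ^+ k *+ 'C(m.+1, k) <= k`!%:R^-1 :> R.
Proof.
rewrite -mulr_natl exprVn ler_pdivrMr ?exprn_gt0 ?ltr0n //.
rewrite mulrC ler_pdivlMr ?ltr0n ?fact_gt0 //.
by rewrite -natrX -natrM ler_nat bin_ffact ffact_le_expn.
Qed.

(** The Taylor polynomial minus [(1 + A / m) ^ m] is a polynomial in [A] with
    nonnegative coefficients, so the triangle inequality reduces the estimate
    to the same difference at the scalar [alpha].  Acting on [B] rather than
    using an operator norm keeps everything in the sup norm. *)
Lemma expmx_partial_sum_sub_euler {R : realType} {n p : nat} (A : 'M[R]_n)
    (B : 'M[R]_(n, p)) (m : nat) (alpha := n%:R * `|A| : R) :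
  `|(series (fun k : nat => (k`!%:R)^-1 *: A ^+ k) m.+2 : 'M[R]_n) *m B
    - (1%:M + m.+1%:R^-1 *: A) ^+ m.+1 *m B|
  <= (expR alpha - (1 + m.+1%:R^-1 * alpha) ^+ m.+1) * `|B|.
Proof.
have alpha0 : 0 <= alpha by rewrite mulr_ge0.
have comm1 : GRing.comm (1%:M : 'M[R]_n) (m.+1%:R^-1 *: A).
  exact: commr_sym (commr1 _).
rewrite -mulmxBl (exprDn_comm _ comm1) /series /= big_mkord -sumrB.
rewrite mulmx_suml (le_trans (ler_norm_sum _ _ _)) //.
pose c (k : nat) : R := k`!%:R^-1 - m.+1%:R^-1 ^+ k *+ 'C(m.+1, k).
rewrite (@le_trans _ _ (\sum_(k < m.+2) (c k * alpha ^+ k) * `|B|)) //.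
  apply: ler_sum => k _.
  rewrite expr1n mul1r scalemx_exprn scalerMnl -scalerBl -scalemxAl normrZ.
  rewrite ger0_norm ?subr_ge0 ?euler_coef_le // -mulrA ler_wpM2l //.
    by rewrite subr_ge0 euler_coef_le.
  exact: mx_norm_exprM.
rewrite -mulr_suml ler_wpM2r // exprDn.
under eq_bigr do rewrite mulrBl.
rewrite sumrB lerB //.
  rewrite (_ : \sum_(k < m.+2) _ = series (exp_coeff alpha) m.+2); last first.
    by rewrite /series /= big_mkord; apply: eq_bigr => k _; rewrite mulrC.
  apply: nondecreasing_cvgn_le (is_cvg_series_exp_coeff _) _.
  apply/nondecreasing_seqP => k; rewrite seriesSr lerDl /exp_coeff /=.
  by rewrite mulr_ge0 // exprn_ge0.
rewrite le_eqVlt; apply/orP; left; apply/eqP/eq_bigr => k _.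
by rewrite expr1n mul1r exprMn mulrnAl.
Qed.

(** With [t = x / m.+1], this is the power [m.+1] of
    [exp (t / (1 + t)) <= 1 + t], the inverse of [1 - s <= exp (- s)] at
    [s = t / (1 + t)]. *)
Lemma expR_le_euler {R : realType} (x : R) (m : nat) : 0 <= x ->
  expR (x / (1 + m.+1%:R^-1 * x)) <= (1 + m.+1%:R^-1 * x) ^+ m.+1.
Proof.
move=> x0; set t := m.+1%:R^-1 * x.
have t0 : 0 <= t by rewrite mulr_ge0.
have t1 : 1 + t > 0 by rewrite (lt_le_trans ltr01) // lerDl.
have -> : x / (1 + t) = m.+1%:R * (t / (1 + t)).
  by rewrite /t !mulrA mulfV ?mul1r // pnatr_eq0.
rewrite expRM_natl ler_pXn2r ?nnegrE ?expR_ge0 ?(ltW t1) //.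
rewrite -[leRHS]invrK -[leLHS]invrK lef_pV2 ?posrE ?invr_gt0 ?expR_gt0 //.
rewrite -expRN (le_trans _ (expR_ge1Dx _)) //.
rewrite le_eqVlt; apply/orP; left; apply/eqP.
by field; rewrite gt_eqF.
Qed.

Lemma cvg_euler_lower {R : realType} (x : R) :
  (fun m : nat => expR (x / (1 + m.+1%:R^-1 * x)) : R) @ \oo --> expR x.
Proof.
have tx : (fun m : nat => m.+1%:R^-1 * x : R) @ \oo --> 0 * x.
  by apply: cvgMl; exact: cvg_harmonic.
have tx1 : (fun m : nat => 1 + m.+1%:R^-1 * x : R) @ \oo --> 1 + 0 * x.
  by apply: cvgD => //; exact: cvg_cst.
have tx2 : (fun m : nat => x / (1 + m.+1%:R^-1 * x) : R) @ \oo --> x.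
  rewrite mul0r addr0 in tx1.
  have := cvgM (cvg_cst x) (cvgV (oner_neq0 R) tx1).
  by rewrite invr1 mulr1; exact.
exact: (continuous_cvg _ (@continuous_expR _ _) tx2).
Qed.

(** * Sub-Markov generators *)

(** These are the generators of sub-Markov semigroups, i.e. the matrices whose
    exponentials [expmx (t *: A)], [t >= 0], have nonnegative entries and row
    sums at most 1. *)
Definition subgenerator {R : realType} {n : nat} (A : 'M[R]_n) : Prop :=
  (forall i j, i != j -> 0 <= A i j) /\ (forall i, \sum_j A i j <= 0).

(** Once the step is small enough for the diagonal of [1 + A / m.+1] to be
    nonnegative, this matrix averages the entries of [B], with total weight at
    most 1 in each row. *)
Lemma subgenerator_euler_contraction {R : realType} {n p : nat} (A : 'M[R]_n)
    (B : 'M[R]_(n, p)) (m : nat) : subgenerator A -> `|A| <= m.+1%:R ->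
  `|(1%:M + m.+1%:R^-1 *: A) ^+ m.+1 *m B| <= `|B|.
Proof.
move=> [Aoff Arow] Am; set Q := _ + _.
have m0 : 0 < m.+1%:R :> R by rewrite ltr0n.
have Q0 i j : 0 <= Q i j.
  rewrite !mxE; have [->|ij] := eqVneq i j; last first.
    by rewrite add0r mulr_ge0 ?Aoff.
  have := le_trans (ler_mx_norm_entry A j j) Am.
  rewrite ler_norml => /andP[Ajj _].
  by rewrite -lerBlDl sub0r mulrC ler_pdivlMr // mulN1r.
have QB (C : 'M[R]_(n, p)) : `|Q *m C| <= `|C|.
  rewrite -[leRHS]mul1r; apply: mx_norm_mulmx_rowsum => // i.
  under eq_bigr do rewrite ger0_norm // !mxE.
  rewrite big_split /= (bigD1 i) //= eqxx big1 => [|j /negPf ji]; last first.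
    by rewrite eq_sym ji.
  by rewrite addr0 -mulr_sumr gerDl mulr_ge0_le0.
elim: m.+1 => [|k IH]; first by rewrite expr0 mul1mx.
by rewrite exprS -mulmxA (le_trans (QB _)).
Qed.

(** The contraction property of [(1 + A / m) ^ m] passes to the limit.  The
    error made for a finite [m] splits into the tail of the exponential series
    and the distance from the Taylor polynomial to [(1 + A / m) ^ m]. *)
Lemma expmx_subgenerator_contraction {R : realType} {n p : nat} (A : 'M[R]_n)
    (B : 'M[R]_(n, p)) : subgenerator A -> `|expmx A *m B| <= `|B|.
Proof.
move=> Agen.
pose S : nat -> 'M[R]_n := series (fun k : nat => (k`!%:R)^-1 *: A ^+ k).
pose alpha : R := n%:R * `|A|.
pose bound (m : nat) : R := n%:R * `|expmx A - S m.+2| * `|B|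
  + (expR alpha - expR (alpha / (1 + m.+1%:R^-1 * alpha))) * `|B| + `|B|.
have bound_cvg : bound @ \oo --> `|B|.
  have SA : (fun m => S m.+2) @ \oo --> expmx A.
    by have := cvg_expmx A; rewrite -(cvg_shiftn 2) /=;
      under eq_fun do rewrite addn2.
  rewrite -[X in _ --> X]add0r -[X in _ --> X + _]add0r.
  apply: cvgD; last exact: cvg_cst.
  apply: cvgD.
    have := cvgM (cvgM (cvg_cst (n%:R : R))
      (cvg_norm (cvgB (cvg_cst (expmx A)) SA))) (cvg_cst `|B|).
    by rewrite subrr normr0 mulr0 mul0r; exact.
  have := cvgM (cvgB (cvg_cst (expR alpha)) (cvg_euler_lower alpha))
    (cvg_cst `|B|).
  by rewrite subrr mul0r; exact.
apply: (@ler_cvg_to _ \oo _ _ (fun=> `|expmx A *m B|) bound) => //.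
  exact: cvg_cst.
near=> m.
have Am : `|A| <= m.+1%:R.
  rewrite (@le_trans _ _ m%:R) ?ler_nat //.
  by near: m; exact: nbhs_infty_ger.
rewrite -(subrK (S m.+2) (expmx A)) mulmxDl.
rewrite -(subrK ((1%:M + m.+1%:R^-1 *: A) ^+ m.+1 *m B) (S m.+2 *m B)).
rewrite (le_trans (ler_normD _ _)) // /bound -[leRHS]addrA lerD //.
  exact: mx_norm_mulmx.
rewrite (le_trans (ler_normD _ _)) // lerD ?subgenerator_euler_contraction //.
rewrite (le_trans (expmx_partial_sum_sub_euler _ _ _)) // ler_wpM2r //.
by rewrite lerD2l lerN2 expR_le_euler // mulr_ge0.
Unshelve. all: by end_near. Qed.

(** * The generators of the splitting scheme *)

Lemma subgeneratorZ {R : realType} {n : nat} (c : R) (A : 'M[R]_n) :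
  0 <= c -> subgenerator A -> subgenerator (c *: A).
Proof.
move=> c0 [Aoff Arow]; split=> [i j ij|i]; first by rewrite mxE mulr_ge0 ?Aoff.
by under eq_bigr do rewrite mxE; rewrite -mulr_sumr mulr_ge0_le0.
Qed.

Lemma subgenerator_diag_mul {R : realType} {n : nat} (d : 'rV[R]_n)
    (A : 'M[R]_n) :
  (forall i, 0 <= d 0 i) -> subgenerator A -> subgenerator (diag_mx d *m A).
Proof.
move=> d0 [Aoff Arow]; rewrite mul_diag_mx; split=> [i j ij|i].
  by rewrite mxE mulr_ge0 ?Aoff.
by under eq_bigr do rewrite mxE; rewrite -mulr_sumr mulr_ge0_le0.
Qed.

Lemma tensmx_rowsum {R : comPzRingType} {m n p q : nat} (A : 'M[R]_(m, n))
    (B : 'M[R]_(p, q)) (k : 'I_(m * p)) :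
  \sum_l (A *t B) k l =
  (\sum_j A (mxtens_unindex k).1 j) * (\sum_j B (mxtens_unindex k).2 j).
Proof.
rewrite (reindex (@mxtens_index n q)) /=; last first.
  exists (@mxtens_unindex n q) => l _; first exact: mxtens_indexK.
  exact: mxtens_unindexK.
rewrite mulr_suml.
under [RHS]eq_bigr do rewrite mulr_sumr.
rewrite pair_big /=; apply: eq_bigr => -[i j] _ /=.
by rewrite mxE mxtens_indexK.
Qed.

Lemma rowsum_1mx {R : pzRingType} {n : nat} (i : 'I_n) :
  \sum_j (1%:M : 'M[R]_n) i j = 1.
Proof.
rewrite (bigD1 i) //= big1 => [|j /negPf ji]; first by rewrite mxE eqxx addr0.
by rewrite mxE eq_sym ji.
Qed.

Lemma subgenerator_tens1mx {R : realType} {m n : nat} (A : 'M[R]_n) :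
  subgenerator A -> subgenerator ((1%:M : 'M[R]_m) *t A).
Proof.
move=> [Aoff Arow]; split=> [k l kl|k]; last first.
  by rewrite tensmx_rowsum rowsum_1mx mul1r.
rewrite !mxE; have [e1|] := eqVneq; last by rewrite mul0r.
rewrite mul1r Aoff //; apply: contra kl => /eqP e2.
rewrite -(inj_eq (can_inj (@mxtens_unindexK m n))).
by rewrite [X in X == _]surjective_pairing e1 e2 -surjective_pairing.
Qed.

Lemma subgenerator_tensmx1 {R : realType} {m n : nat} (A : 'M[R]_m) :
  subgenerator A -> subgenerator (A *t (1%:M : 'M[R]_n)).
Proof.
move=> [Aoff Arow]; split=> [k l kl|k]; last first.
  by rewrite tensmx_rowsum rowsum_1mx mulr1.
rewrite !mxE; have [e2|] := eqVneq; last by rewrite mulr0.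
rewrite mulr1 Aoff //; apply: contra kl => /eqP e1.
rewrite -(inj_eq (can_inj (@mxtens_unindexK m n))).
by rewrite [X in X == _]surjective_pairing e1 e2 -surjective_pairing.
Qed.

Lemma sum_const_at_most_one {I : finType} {R : numDomainType} (P : pred I)
    (c : R) :
  0 <= c -> {in P &, forall i j, i = j} -> \sum_(i | P i) c <= c.
Proof.
move=> c0 Pinj; rewrite sumr_const -[leRHS]mulr1n ler_wpMn2l //.
by apply/card_le1P => i Pi j; apply/idP/eqP => [Pj|->//]; exact: Pinj.
Qed.

(** The off-diagonal entries of an interior row balance its diagonal entry
    exactly; in the first and last rows those that belong to boundary points
    fall outside the matrix, which can only decrease the sum. *)
Lemma subgenerator_Tmx {R : realType} {N : nat} (x : nat -> R) :
  is_mesh N x -> subgenerator (Tmx N x).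
Proof.
move=> [_ _ x_incr].
have h0 k : (k <= N)%N -> 0 < mesh_step x k.
  by move=> kN; rewrite subr_gt0 x_incr.
have coef_ge0 p q : 0 < p -> 0 < q -> 0 <= 2 / (q * (p + q)) :> R.
  by move=> p0 q0; rewrite ltW // divr_gt0 // mulr_gt0 // addr_gt0.
split=> [i j|i].
  rewrite mxE eq_sym => /negPf; rewrite -val_eqE /= => ->.
  case: eqP => [ji|_].
    by apply: coef_ge0; rewrite h0 // ltnW.
  case: eqP => [ij|//].
  have jN : (j.+2 <= N)%N by rewrite -ij.
  by rewrite (addrC (mesh_step x j.+1)) coef_ge0 // h0 // ltnW.
have hi : 0 < mesh_step x i by rewrite h0 // ltnW.
have hi1 : 0 < mesh_step x i.+1 by rewrite h0.
set p := mesh_step x i in hi *; set q := mesh_step x i.+1 in hi1 *.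
(* The three terms have disjoint supports, so this is in fact an equality. *)
have Tle j : Tmx N x i j <= (if j == i then - (2 / (p * q)) else 0)
    + (if j == i.+1 :> nat then 2 / (q * (p + q)) else 0)
    + (if i == j.+1 :> nat then 2 / (p * (p + q)) else 0).
  rewrite mxE -val_eqE /=; have [->|ji] := eqVneq (val j) (val i).
    by rewrite [_ == _.+1]ltn_eqF // !addr0.
  have [->|jSi] := eqVneq (val j) i.+1.
    by rewrite [_ == _]ltn_eqF // add0r addr0.
  by have [ij|_] := eqVneq (val i) j.+1; rewrite ?add0r // /p /q ij.
rewrite (le_trans (ler_sum _ (fun j _ => Tle j))) //.
rewrite !big_split /= -!big_mkcond /= big_pred1_eq.
have pq0 : 0 < p + q by rewrite addr_gt0.
apply: (@le_trans _ _
  (- (2 / (p * q)) + 2 / (q * (p + q)) + 2 / (p * (p + q)))).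
  rewrite lerD ?lerD //; apply: sum_const_at_most_one.
  - exact: coef_ge0.
  - by move=> j k /eqP j1 /eqP k1; apply: val_inj; rewrite /= j1 k1.
  - by rewrite (addrC p) coef_ge0.
  - by move=> j k /eqP j1 /eqP k1; apply: val_inj; apply: succn_inj;
      rewrite /= -j1.
rewrite le_eqVlt; apply/orP; left; apply/eqP; field.
by rewrite !gt_eqF.
Qed.

Lemma mesh_itv {R : realType} {N : nat} (x : nat -> R) (i : nat) :
  is_mesh N x -> (i <= N.+1)%N -> -1 <= x i <= 1.
Proof.
move=> [x0 x1 x_incr] iN.
have mono j k : (j <= k <= N.+1)%N -> x j <= x k.
  elim: k => [|k IH]; first by rewrite leqn0 => /andP[/eqP->].
  rewrite leq_eqVlt => /andP[/predU1P[->//|jk] kN].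
  have jkN : (j <= k <= N.+1)%N by rewrite -ltnS jk ltnW.
  by rewrite (le_trans (IH jkN)) // ltW // x_incr.
by rewrite -{1}x0 -x1 !mono ?iN ?leqnn.
Qed.

(** * Comparison of norms and stability *)

Section Norm2.
Context {R : realType} {n : nat}.

Lemma mx_norm_le_norm2 (v : 'cV[R]_n) : `|v| <= norm2 v.
Proof.
apply: mx_norm_ler => [|i j]; first exact: sqrtr_ge0.
rewrite ord1 -sqrtr_sqr ler_wsqrtr // (bigD1 i) //= lerDl sumr_ge0 // => k _.
exact: sqr_ge0.
Qed.

Lemma norm2_le_mx_norm (v : 'cV[R]_n) : norm2 v <= Num.sqrt n%:R * `|v|.
Proof.
rewrite -[X in _ * X](ger0_norm (normr_ge0 v)) -sqrtr_sqr -sqrtrM //.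
rewrite ler_wsqrtr // (@le_trans _ _ (\sum_(i < n) `|v| ^+ 2)) //.
  apply: ler_sum => i _.
  by rewrite -real_normK ?num_real // ler_pXn2r ?nnegrE // ler_mx_norm_entry.
by rewrite sumr_const card_ord mulr_natl.
Qed.

End Norm2.

Lemma Phi_contraction {R : realType} {n p : nat} (Ax Ay : 'M[R]_n) (tau : R)
    (B : 'M[R]_(n, p)) :
  subgenerator Ax -> subgenerator Ay -> 0 <= tau ->
  `|Phi Ax Ay tau *m B| <= `|B|.
Proof.
move=> Axgen Aygen tau0.
have gx : subgenerator ((tau / 2) *: Ax).
  by apply: subgeneratorZ; rewrite ?divr_ge0.
have gy : subgenerator (tau *: Ay) by exact: subgeneratorZ.
rewrite /Phi -!mulmxA.
rewrite (le_trans (expmx_subgenerator_contraction _ _ gx)) //.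
rewrite (le_trans (expmx_subgenerator_contraction _ _ gy)) //.
exact: expmx_subgenerator_contraction.
Qed.

Theorem theorem5p1 (R : realType) (Nx Ny : nat) (hNx : (0 < Nx)%N)
    (hNy : (0 < Ny)%N) (a b : R) (ha : 0 < a) (hb : 0 < b)
    (x y : nat -> R) (hx : is_mesh Nx x) (hy : is_mesh Ny y)
    (sigma : R -> R -> R) (hsigma : is_degeneracy sigma) :
  exists taustar : R, 0 < taustar /\
  exists C : R, 0 < C /\
  forall tau : nat -> R, (forall k : nat, 0 <= tau k <= taustar) ->
  forall z : nat -> 'cV[R]_(Ny * Nx),
    (forall k : nat,
       z k.+1 = Phi (Mx Nx Ny x y sigma a) (My Nx Ny x y sigma b) (tau k)
                *m z k) ->
  forall k : nat, norm2 (z k.+1) <= C * norm2 (z 0%N).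
Proof.
have B_ge0 (k : 'I_(Ny * Nx)) : 0 <= (\row_(k < Ny * Nx)
    let ji := mxtens_unindex k in (sigma (x ji.2.+1) (y ji.1.+1))^-1) 0 k.
  rewrite mxE invr_ge0.
  case: (hsigma (x (mxtens_unindex k).2.+1) (y (mxtens_unindex k).1.+1)) => //;
    by [apply: (mesh_itv _ _ hx); rewrite ltnS ltnW
       | apply: (mesh_itv _ _ hy); rewrite ltnS ltnW].
have Mx_gen : subgenerator (Mx Nx Ny x y sigma a).
  apply: subgeneratorZ; first by rewrite invr_ge0 sqr_ge0.
  apply: subgenerator_diag_mul B_ge0 _.
  exact/subgenerator_tens1mx/subgenerator_Tmx.
have My_gen : subgenerator (My Nx Ny x y sigma b).
  apply: subgeneratorZ; first by rewrite invr_ge0 sqr_ge0.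
  apply: subgenerator_diag_mul B_ge0 _.
  exact/subgenerator_tensmx1/subgenerator_Tmx.
(* Contraction holds for all nonnegative steps, so any bound on them will do. *)
exists 1; split=> //.
exists (Num.sqrt (Ny * Nx)%:R); split.
  by rewrite sqrtr_gt0 ltr0n muln_gt0 hNy.
move=> tau tau_ge0 z z_rec k.
have z_le j : `|z j| <= `|z 0%N|.
  elim: j => [//|j IH]; rewrite z_rec (le_trans _ IH) // Phi_contraction //.
  by case/andP: (tau_ge0 j).
rewrite (le_trans (norm2_le_mx_norm _)) // ler_wpM2l ?sqrtr_ge0 //.
exact: le_trans (z_le _) (mx_norm_le_norm2 _).
Qed.
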